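(* Let $A\in\mathcal{S}$ be a nondegenerate sequence such that $s(x;A)\gg x^{\varepsilon}$ for some $\varepsilon>0$. If for some integer $d\geqslant 1/\varepsilon$, $$ \sum_{n\leqslant x} r_d(n;A)^2 \ll \frac{s_d(x;A)^2}{x}, $$ then $A\cup\{0\}$ is an asymptotic basis, i.e. there is an integer $h$ such that every sufficiently large integer is a sum of $h$ elements of $A\cup\{0\}$.
   Context: $\mathcal{S}$ denotes the set of infinite subsets of $\mathbb{Z}_{\geqslant 0}$. For $A\in\mathcal{S}$, $r(n;A)=r_1(n;A)$ is the indicator of $n\in A$; for $d\geqslant 2$, $r_d(n;A)=\sum_{k_1+\dots+k_d=n} r(k_1;A)\cdots r(k_d;A)$. For real $x\geqslant0$, $s(x;A)=s_1(x;A)=|A\cap[0,x]|$, $s_d(x;A)=\sum_{0\leqslant n\leqslant x} r_d(n;A)$. We set $\gcd(A):=\min_{a,b\in A}\gcd(a,b)$, and $A$ is nondegenerate if $\gcd(A)=1$. $f\ll g$ means $\limsup_{x\to+\infty}|f/g|<+\infty$. *)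

(* Defs.v *)
From mathcomp Require Import all_boot all_order all_algebra.
From mathcomp Require Import all_classical all_reals all_analysis.
Set Implicit Arguments.
Unset Strict Implicit.
Unset Printing Implicit Defensive.
Import Order.TTheory GRing.Theory Num.Theory.
Import numFieldNormedType.Exports.

Local Open Scope classical_set_scope.
Local Open Scope nat_scope.

Definition indic_nat (A : set nat) (n : nat) : nat := `[< A n >].

(* r_d(n; A): the sum runs over ordered d-tuples; each k_i is automatically
   at most n, hence the codomain 'I_n.+1. *)
Definition rep (d : nat) (A : set nat) (n : nat) : nat :=
  \sum_(k : {ffun 'I_d -> 'I_n.+1} | \sum_(i < d) k i == n)
     \prod_(i < d) indic_nat A (k i).

Lemma rep1 (A : set nat) (n : nat) : rep 1 A n = indic_nat A n.
Proof.
rewrite /rep (big_pred1 [ffun=> ord_max]) => [|k].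
  by rewrite big_ord1 ffunE.
rewrite big_ord1 /=; apply/eqP/eqP => [kn|->]; last by rewrite ffunE.
by apply/ffunP => i; rewrite ffunE ord1; apply: val_inj.
Qed.

(* For x >= 0, the naturals n <= x are exactly those with
   n < (Num.truncn x).+1. *)
Definition count_le (R : realType) (A : set nat) (x : R) : nat :=
  #|[pred n : 'I_(Num.truncn x).+1 | `[< A n >]]|.

Definition sum_rep (R : realType) (d : nat) (A : set nat) (x : R) : nat :=
  \sum_(0 <= n < (Num.truncn x).+1) rep d A n.

Definition sum_rep_sq (R : realType) (d : nat) (A : set nat) (x : R) : nat :=
  \sum_(0 <= n < (Num.truncn x).+1) rep d A n ^ 2.

Lemma sum_rep1 (R : realType) (A : set nat) (x : R) :
  sum_rep 1 A x = count_le A x.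
Proof.
rewrite /sum_rep /count_le big_mkord -sum1_card [RHS]big_mkcond /=.
by apply: eq_bigr => i _; rewrite rep1 /indic_nat inE; case: asboolP.
Qed.

(* g = min of gcd(a, b) over a, b in A. The undefined pair a = b = 0 is left
   out: with the convention gcdn 0 0 = 0 it would make the minimum 0 for every
   A containing 0. *)
Definition is_gcd_set (A : set nat) (g : nat) : Prop :=
  (exists a b, [/\ A a, A b, (a, b) != (0, 0) & gcdn a b = g]) /\
  (forall a b, A a -> A b -> (a, b) != (0, 0) -> g <= gcdn a b).

Definition nondegenerate_set (A : set nat) : Prop := is_gcd_set A 1.

Definition vinogradov (R : realType) (f g : R -> R) : Prop :=
  (limf_esup (fun x => `|f x / g x|%:E) (pinfty_nbhs R) < +oo)%E.

Definition asymptotic_basis (B : set nat) : Prop :=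
  exists h N : nat, forall n, N <= n ->
    exists2 k : 'I_h -> nat, (forall i, B (k i)) & n = \sum_(i < h) k i.

(* Main.v *)
(* By Cauchy-Schwarz, the mean-square bound makes the support of [r_d], that is
   [d A], a set of positive lower density.  Since [A] contains two coprime
   elements, some [m]-fold sumset of [A U {0}] contains two consecutive integers
   [t] and [t + 1].  The set [D = d (A U {0}) U {1}] contains 0 and 1,
   hence has positive Schnirelmann density, so every integer is a sum of [h]
   elements of [D]; adding [t] to each of these summands turns the summand 1 into
   [t + 1] and makes every integer [>= h t] a sum of [h (d + m)] elements of
   [A U {0}]. *)

Require Import Defs.
From mathcomp Require Import all_boot all_order all_algebra.
From mathcomp Require Import all_classical all_reals all_analysis.
From mathcomp Require Import zify.

Import Order.TTheory GRing.Theory Num.Theory.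

Local Open Scope classical_set_scope.
Local Open Scope nat_scope.

Definition sumset (h : nat) (B : set nat) : set nat := fun n =>
  exists2 k : 'I_h -> nat, (forall i, B (k i)) & n = \sum_(i < h) k i.

(** Schnirelmann density at least [1 / q] reads [q * missing B n <= q.-1 * n] for all [n], without
    division; when sets are added, these complementary proportions multiply. *)
Definition missing (B : set nat) (n : nat) : nat :=
  \sum_(1 <= i < n.+1) ~~ `[< B i >].

Lemma sumset0 (B : set nat) : sumset 0 B 0.
Proof. by exists (fun=> 0) => [[]//|]; rewrite big_ord0. Qed.

Lemma sumset1 (B : set nat) (n : nat) : B n -> sumset 1 B n.
Proof. by move=> Bn; exists (fun=> n) => //; rewrite big_ord1. Qed.

Lemma sumsetD {B : set nat} {h1 h2 n1 n2 : nat} :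
  sumset h1 B n1 -> sumset h2 B n2 -> sumset (h1 + h2) B (n1 + n2).
Proof.
move=> [k1 Bk1 ->] [k2 Bk2 ->].
exists (fun i => match fintype.split i with inl j => k1 j | inr j => k2 j end).
  by move=> i; case: fintype.split.
rewrite big_split_ord /=; congr (_ + _); apply: eq_bigr => i _.
  by rewrite -/(unsplit (inl i)) unsplitK.
by rewrite -/(unsplit (inr i)) unsplitK.
Qed.

Lemma sumsetM (B : set nat) (h n : nat) : B n -> sumset h B (h * n).
Proof.
by move=> Bn; exists (fun=> n) => //; rewrite sum_nat_const card_ord.
Qed.

Lemma sumset_mono (B : set nat) (h1 h2 n : nat) :
  B 0 -> h1 <= h2 -> sumset h1 B n -> sumset h2 B n.
Proof.
move=> B0 h12 Bn; rewrite -(subnKC h12) -[n]addn0; apply: sumsetD => //.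
by rewrite -(muln0 (h2 - h1)); apply: sumsetM.
Qed.

Lemma sumset_sub {B1 B2 : set nat} {h n : nat} :
  B1 `<=` B2 -> sumset h B1 n -> sumset h B2 n.
Proof. by move=> B12 [k Bk ->]; exists k => // i; apply: B12. Qed.

Lemma sumset_shift (P B : set nat) (k t h n : nat) :
  (forall x, P x -> sumset k B (x + t)) ->
  sumset h P n -> sumset (h * k) B (n + h * t).
Proof.
move=> PB [f Pf ->]; elim: h f Pf => [|h IH] f Pf.
  by rewrite big_ord0 !mul0n; apply: sumset0.
rewrite big_ord_recr /= !mulSnr addnACA.
by apply: sumsetD; [apply: IH => i; apply: Pf | apply: PB].
Qed.

Lemma missingS (B : set nat) (n : nat) :
  missing B n.+1 = missing B n + ~~ `[< B n.+1 >].
Proof. by rewrite /missing big_nat_recr. Qed.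

(* Schnirelmann's inequality: cut at the last element [a] of [P] before [n];
   no element of (a, n] is in [P], while [a + B] covers part of it. *)
Lemma missing_add {P B C : set nat} {q : nat} :
  P 0 -> B 0 -> (forall a b, P a -> B b -> C (a + b)) ->
  (forall n, q * missing B n <= q.-1 * n) ->
  forall n, q * missing C n <= q.-1 * missing P n.
Proof.
move=> P0 B0 PBC qB n.
have PC m : P m -> C m by move=> Pm; rewrite -[m]addn0; apply: PBC.
have [a [an Pa qa Cn Pn]] : exists a, [/\ a <= n, P a,
    q * missing C a <= q.-1 * missing P a,
    missing C n <= missing C a + missing B (n - a) &
    missing P n = missing P a + (n - a)].
  elim: n => [|n [a [an Pa qa Cn Pn]]].
    by exists 0; split; rewrite ?subnn ?addn0 ?leq_addr // /missing !big_geq ?muln0.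
  have [PnS|PnS] := pselect (P n.+1).
    exists n.+1; split; rewrite ?subnn ?addn0 ?leq_addr //.
    (* The gap of [n - a] integers before [n.+1] closes: by [qB], at most the fraction [q.-1 / q] of
       it is missing from [C]. *)
    have := qB (n - a); rewrite !missingS !asboolT //; last exact: PC.
    by rewrite !addn0 Pn; nia.
  exists a; split=> //; first exact: ltnW.
    rewrite subSn // !missingS addnA leq_add //.
    have [Bna|Bna] := pselect (B (n - a).+1); last by rewrite (asboolF Bna) leq_b1.
    by rewrite !asboolT // -(subnKC an) -addnS; apply: PBC.
  by rewrite missingS (asboolF PnS) Pn subSn // addnS addn1.
by have := qB (n - a); rewrite Pn; nia.
Qed.

(** Pigeonhole: otherwise [i] or [n - i] is missing for each [i <= n], so
    [n + 1 <= 2 * missing B n]. As [0] is in [B], the count may start at [0], and its range is then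
    symmetric under [i -> n - i]. *)
Lemma missing_pair (B : set nat) (n : nat) :
  B 0 -> 2 * missing B n < n -> exists2 a, a <= n & B a /\ B (n - a).
Proof.
move=> B0 Bn; apply: contrapT => noa.
have mE : missing B n = \sum_(0 <= i < n.+1) ~~ `[< B i >].
  by rewrite [RHS]big_ltn // asboolT.
have : n.+1 <= missing B n + missing B n; last by lia.
rewrite {1}mE mE [X in _ + X]big_nat_rev -big_split /=.
rewrite -[X in X <= _]subn0 -[X in X <= _]muln1 -sum_nat_const_nat.
rewrite big_nat_cond [X in _ <= X]big_nat_cond; apply: leq_sum => i.
rewrite andbT add0n subSS => /andP[_ iN].
case: asboolP => Bi; case: asboolP => Bni //=.
by case: noa; exists i => //; rewrite -ltnS.
Qed.

(* Bernoulli: [(1 + 1 / q) ^ k >= 1 + k / q > 2] for [k = 2 q + 1]. *)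
Lemma expn_gt_double (q : nat) : 2 * q ^ (2 * q).+1 < q.+1 ^ (2 * q).+1.
Proof.
have bern k : q ^ k.+1 + k.+1 * q ^ k <= q.+1 ^ k.+1.
  elim: k => [|k IH]; first by rewrite !expn1 expn0; lia.
  rewrite [q.+1 ^ _]expnS; apply: leq_trans (leq_mul (leqnn _) IH).
  by rewrite !expnS; nia.
have [->|q0] := posnP q; first by [].
by apply: leq_trans (bern _); rewrite expnS; have := expn_gt0 q (2 * q); nia.
Qed.

(** By [missing_add], the proportion missing from the [k]-fold sumset is at most
    [(q / (q + 1)) ^ k]. For [k = 2 q + 1] it is below one half, and [missing_pair] applies. *)
Theorem schnirelmann (B : set nat) (q : nat) :
  B 0 -> (forall n, q.+1 * missing B n <= q * n) ->
  exists h, forall n, sumset h B n.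
Proof.
move=> B0 qB.
have B0s k : sumset k B 0 by rewrite -(muln0 k); apply: sumsetM.
have density k n : q.+1 ^ k.+1 * missing (sumset k.+1 B) n <= q ^ k.+1 * n.
  elim: k => [|k IH].
    rewrite !expn1; apply: leq_trans (qB n); rewrite leq_mul2l /=.
    apply: leq_sum => i _; case: asboolP => // nBi; case: asboolP => // Bi.
    by case: nBi; apply: sumset1.
  have step : q.+1 * missing (sumset k.+2 B) n <= q * missing (sumset k.+1 B) n.
    apply: (@missing_add _ B _ q.+1) => // a b Ba Bb.
    by rewrite -[k.+2]addn1; apply: sumsetD => //; apply: sumset1.
  rewrite expnSr -mulnA (leq_trans (leq_mul (leqnn _) step)) //.
  by rewrite mulnCA [q ^ _]expnS -mulnA leq_mul.
pose k := (2 * q).+1; exists (k + k) => -[|n]; first exact: B0s.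
have [a an [Ba Bna]] : exists2 a, a <= n.+1 & sumset k B a /\ sumset k B (n.+1 - a).
  apply: missing_pair => //; have := density (2 * q) n.+1; rewrite -/k.
  by have := expn_gt_double q; rewrite -/k; nia.
by rewrite -(subnKC an); apply: sumsetD.
Qed.

Lemma cauchy_schwarz_support (r : nat -> nat) (n : nat) :
  (\sum_(0 <= i < n) r i) ^ 2 <=
  (\sum_(0 <= i < n) (0 < r i)) * \sum_(0 <= i < n) r i ^ 2.
Proof.
(* Doubled, the inequality holds termwise in the double sums: [2 r_i r_j <= r_i ^ 2 + r_j ^ 2] when
   both are positive, and the left side vanishes otherwise. *)
suff : (\sum_(0 <= i < n) r i) * (\sum_(0 <= i < n) r i) +
    (\sum_(0 <= i < n) r i) * (\sum_(0 <= i < n) r i) <=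
    (\sum_(0 <= i < n) (0 < r i)) * (\sum_(0 <= i < n) r i ^ 2) +
    (\sum_(0 <= i < n) r i ^ 2) * (\sum_(0 <= i < n) (0 < r i)) by nia.
rewrite !big_distrlr -!big_split; apply: leq_sum => i _.
rewrite -!big_split; apply: leq_sum => j _ /=.
have [+ _] := nat_Cauchy (r i) (r j).
case: (posnP (r i)) => [->|_]; first by rewrite !mul0n.
case: (posnP (r j)) => [->|_]; first by rewrite !muln0.
by rewrite mul1n muln1 addnn -mul2n addnC.
Qed.

Lemma rep_gt0P (d : nat) (A : set nat) (n : nat) :
  0 < rep d A n <-> sumset d A n.
Proof.
split=> [|[k Ak nE]].
  rewrite lt0n sum_nat_eq0 negb_forall => /existsP[k].
  rewrite negb_imply -lt0n => /andP[/eqP kn Ak].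
  exists (fun i => nat_of_ord (k i)) => // i; move: Ak; rewrite (bigD1 i) //= muln_gt0 => /andP[+ _].
  by rewrite /indic_nat; case: asboolP.
have kn i : k i < n.+1 by rewrite ltnS nE (bigD1 i) //= leq_addr.
rewrite /rep (bigD1 [ffun i => Ordinal (kn i)]) /=; last first.
  by apply/eqP; rewrite [RHS]nE; apply: eq_bigr => i _; rewrite ffunE.
rewrite ltn_addr // prodn_gt0 // => i.
by rewrite ffunE /= /indic_nat asboolT.
Qed.

Lemma vinogradov_bound {R : realType} {f g : R -> R} :
  vinogradov f g ->
  exists K M : R, forall x, (M < x -> `|f x / g x| <= K)%R.
Proof.
move=> /ereal_inf_lt[_ [V [M [_ MV]] <-]].
set sup := ereal_sup _ => sup_fin.
have ub x : (M < x)%R -> (`|f x / g x|%:E <= sup)%E.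
  by move=> Mx; apply: ereal_sup_ubound; exists x => //; apply: MV.
by case: sup sup_fin ub => [K| |] // _ ub; [exists K, M | exists 0%R, M] => x /ub.
Qed.

Lemma sum_rep_sq_bound {R : realType} {A : set nat} {d : nat} :
  infinite_set A ->
  vinogradov (fun x : R => (sum_rep_sq d A x)%:R%R)
             (fun x : R => (sum_rep d A x)%:R ^+ 2 / x)%R ->
  exists K N, forall n, N <= n ->
    0 < \sum_(0 <= i < n.+1) rep d A i /\
    n * \sum_(0 <= i < n.+1) rep d A i ^ 2 <=
    K * (\sum_(0 <= i < n.+1) rep d A i) ^ 2.
Proof.
move=> /infinite_setN0[a Aa] /vinogradov_bound[K [M KM]].
(* Beyond [M] the bound applies at [x = n]; beyond [d * a], a sum of [d] copies of [a], the
   denominator is positive. *)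
exists (Num.truncn `|K|).+1, ((Num.truncn `|M|).+1 + d * a).+1 => n Nn.
have s0 : 0 < \sum_(0 <= i < n.+1) rep d A i.
  rewrite (bigD1_seq (d * a)) ?iota_uniq //= ?mem_index_iota; last by lia.
  by rewrite ltn_addr //; apply/rep_gt0P/sumsetM.
split=> //.
have Mn : (M < n%:R)%R.
  rewrite (le_lt_trans (ler_norm M)) // (lt_le_trans (truncnS_gt _)) // ler_nat.
  by rewrite (leq_trans _ Nn) // leqW // leq_addr.
have := KM _ Mn; rewrite /sum_rep_sq /sum_rep natrK.
set s := \sum_(0 <= i < n.+1) rep d A i; set Q := \sum_(0 <= i < n.+1) _ ^ 2.
rewrite invf_div mulrA ger0_norm ?divr_ge0 ?mulr_ge0 ?exprn_ge0 //.
rewrite ler_pdivrMr ?exprn_gt0 ?ltr0n // => QK.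
rewrite -(ler_nat R) natrM [leRHS]natrM natrX mulrC (le_trans QK) // ler_wpM2r ?exprn_ge0 //.
by rewrite (le_trans (ler_norm K)) // ltW // truncnS_gt.
Qed.

(** In the notation of the proof, [n * Q <= K * s ^ 2 <= K * S * Q] by Cauchy-Schwarz, and [Q]
    cancels, being positive because [s] is. *)
Lemma rep_support_density {R : realType} {A : set nat} {d : nat} :
  infinite_set A ->
  vinogradov (fun x : R => (sum_rep_sq d A x)%:R%R)
             (fun x : R => (sum_rep d A x)%:R ^+ 2 / x)%R ->
  exists K N, forall n, N <= n -> n <= K * \sum_(0 <= i < n.+1) (0 < rep d A i).
Proof.
move=> Ainf /(sum_rep_sq_bound Ainf)[K [N KN]]; exists K, N => n /KN[].
have := cauchy_schwarz_support (rep d A) n.+1.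
set s := \sum_(0 <= i < n.+1) rep d A i.
set S := \sum_(0 <= i < n.+1) (0 < _); set Q := \sum_(0 <= i < n.+1) _ ^ 2.
move=> CS s0 QK.
have Q0 : 0 < Q by rewrite lt0n; apply: contraTneq CS => ->; nia.
rewrite -(leq_pmul2r Q0) -mulnA (leq_trans QK) //.
by rewrite leq_mul.
Qed.

(** Bezout in the naturals: for coprime [a], [b] in [A] with [a > 0] there are [u], [v] with
    [u * a = v * b + 1]. Take [t = v * b] and pad both sums with zeros to [maxn u v] terms. *)
Lemma consecutive_sumset {A : set nat} :
  nondegenerate_set A ->
  exists m t, sumset m (A `|` [set 0]) t /\ sumset m (A `|` [set 0]) t.+1.
Proof.
move=> [[a [b [Aa Ab ab0 gab]]] _].
wlog a0 : a b Aa Ab ab0 gab / 0 < a => [wl|].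
  have [a0|/(wl a b)] := posnP a; last exact.
  by apply: (wl b a); rewrite // 1?gcdnC //; case: b {wl Ab gab} ab0; rewrite ?a0.
have [u v uv _] := egcdnP b a0; rewrite gab addn1 in uv.
exists (maxn u v), (v * b); rewrite -uv; split.
  by apply: (sumset_mono _ v); [right | apply: leq_maxr | apply: sumsetM; left].
by apply: (sumset_mono _ u); [right | apply: leq_maxl | apply: sumsetM; left].
Qed.

Local Open Scope ring_scope.

Theorem theorem2p10 (R : realType) (A : set nat) (eps : R) (d : nat) :
  infinite_set A ->
  nondegenerate_set A ->
  0 < eps ->
  vinogradov (fun x : R => x `^ eps) (fun x : R => (count_le A x)%:R) ->
  1 / eps <= d%:R ->
  vinogradov (fun x : R => (sum_rep_sq d A x)%:R)
             (fun x : R => (sum_rep d A x)%:R ^+ 2 / x) ->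
  asymptotic_basis (A `|` [set 0%N]).
Proof.
move=> Ainf Andeg _ _ _ /(rep_support_density Ainf)[K [N KN]].
have [m [t [mt mt1]]] := consecutive_sumset Andeg.
set A0 := A `|` _ in mt mt1 *.
(* The density bound is so far known only for [n >= N]; the element [1] makes the count positive for
   [0 < n < N] too. *)
pose D : set nat := sumset d A0 `|` [set 1%N].
have D0 : D 0%N by left; rewrite -(muln0 d); apply: sumsetM; right.
pose cover n := (\sum_(1 <= i < n.+1) `[< D i >])%N.
have coverE n : (cover n + missing D n = n)%N.
  rewrite /cover /missing -big_split /= -[RHS]muln1 -[in RHS](subn0 n).
  by rewrite -subSS -sum_nat_const_nat; apply: eq_bigr => i _; case: asboolP.
have cover_gt0 n : (0 < n)%N -> (0 < cover n)%N.
  by case: n => // n _; rewrite /cover big_ltn // asboolT //; right.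
(* The support is counted from [0] and [cover] from [1], hence the successor. *)
have Kcover n : (N <= n)%N -> (n <= K * (cover n).+1)%N.
  move=> /KN nK; apply: (leq_trans nK); rewrite leq_mul2l; apply/orP; right.
  rewrite big_ltn // -[leqRHS]add1n leq_add ?leq_b1 //; apply: leq_sum => i _.
  have [/rep_gt0P Ai|] := boolP (0 < rep d A i)%N; last by [].
  by rewrite asboolT //; left; apply: sumset_sub Ai; left.
(* For [q = 2 * K + N] the density condition amounts to [n <= q.+1 * cover n]. As [cover n >= 1] for
   [n > 0], it follows from [n <= 2 * K * cover n] if [n >= N], and from [n < N] otherwise. *)
have [|h hD] := schnirelmann D (2 * K + N) D0 _.
  move=> n; have [->|n0] := posnP n; first by rewrite /missing big_geq ?muln0.
  have := cover_gt0 n n0; have := coverE n.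
  have [/Kcover|] := leqP N n; nia.
exists (h * (d + m))%N, (h * t)%N => n hn.
rewrite -(subnK hn); apply: sumset_shift (hD _) => x [dx|->].
  exact: sumsetD.
by rewrite add1n; apply: (sumset_mono _ m); [right | apply: leq_addl |].
Qed.
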